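(* If $X$ is an H-closed (Hausdorff) space, then $L'(X)=\aleph_0$.
   Context: A Hausdorff space $X$ is H-closed if every open cover $\mathcal V$ of $X$ has a finite subfamily $\mathcal W$ with $X=\bigcup_{W\in\mathcal W}cl\,W$. An open ultrafilter on a Hausdorff space $X$ is a maximal filter in the family of open subsets of $X$ (its members are nonempty open sets); it converges to $x\in X$ if it contains every open set containing $x$. $EX$ is the set of all convergent open ultrafilters on $X$. A section is a function $b:X\to EX$ such that $b(x)$ converges to $x$ for every $x\in X$. For a section $b$ and an open set $U$ let $\widehat{U}_b=\{x\in X: U\in b(x)\}$, and for $A\subseteq X$ let $c_b(A)=\{x\in X:\widehat{U}_b\cap A\neq\varnothing\text{ for every open }U\ni x\}$. $A$ is $c_b$-closed if $c_b(A)=A$. For $A\subseteq X$, $aL(A,X)$ is the least infinite cardinal $\kappa$ such that every cover $\mathcal V$ of $A$ by open sets of $X$ has a subfamily $\mathcal W$ with $|\mathcal W|\leq\kappa$ and $A\subseteq\bigcup_{W\in\mathcal W}cl\,W$. Put $aL^b(X)=\sup\{aL(C,X): C\text{ is }c_b\text{-closed}\}+\aleph_0$ and $aL'(X)=\min\{aL^b(X): b\text{ a section}\}$. Fix any section $b'$ with $aL^{b'}(X)=aL'(X)$ and write $\widehat{U}=\widehat{U}_{b'}$. $L'(X)$ is the least infinite cardinal $\kappa$ such that for every open cover $\mathcal V$ of $X$ there is $\mathcal W\subseteq\mathcal V$ with $|\mathcal W|\leq\kappa$ and $X=\bigcup_{W\in\mathcal W}\widehat{W}$. *)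

(* Defs.v *)
From HB Require Import structures.
From mathcomp Require Import all_boot.
From mathcomp Require Import all_classical topology.

Set Implicit Arguments.
Unset Strict Implicit.
Unset Printing Implicit Defensive.

Local Open Scope classical_set_scope.
Local Open Scope card_scope.

(* A cardinal is represented by any type K having that cardinality; cardinals
   are compared with [#<=] and [#=], so a cardinal invariant is given as the
   relation "K represents the value of the invariant", which determines K up
   to equipotence. *)

Definition least_infinite_cardinal (P : Type -> Prop) (K : Type) : Prop :=
  [/\ infinite_set [set: K], P K &
      forall K' : Type, infinite_set [set: K'] -> P K' ->
        [set: K] #<= [set: K']].

Definition supremum_cardinal (P : Type -> Prop) (K : Type) : Prop :=
  (forall K' : Type, P K' -> [set: K'] #<= [set: K]) /\
  (forall M : Type, (forall K' : Type, P K' -> [set: K'] #<= [set: M]) ->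
     [set: K] #<= [set: M]).

Definition minimum_cardinal (P : Type -> Prop) (K : Type) : Prop :=
  P K /\ forall K' : Type, P K' -> [set: K] #<= [set: K'].

Section Spaces.
Variable X : topologicalType.

Definition open_cover_of (A : set X) (V : set (set X)) : Prop :=
  (forall U, V U -> open U) /\ A `<=` \bigcup_(U in V) U.

Definition H_closed : Prop :=
  hausdorff_space X /\
  forall V : set (set X), open_cover_of setT V ->
    exists W : set (set X),
      [/\ finite_set W, W `<=` V & setT = \bigcup_(U in W) closure U].

(* Filters in the family of open sets, as opposed to the library's filters
   of arbitrary sets; in particular [F] contains open sets only. *)
Record open_filter (F : set (set X)) : Prop := OpenFilter {
  open_filter_open : forall U, F U -> open U;
  open_filter_nonempty : F !=set0;
  open_filter_proper : forall U, F U -> U !=set0;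
  open_filterI : forall U V, F U -> F V -> F (U `&` V);
  open_filterS : forall U V, F U -> open V -> U `<=` V -> F V
}.

Definition open_ultrafilter (F : set (set X)) : Prop :=
  open_filter F /\ forall G, open_filter G -> F `<=` G -> G = F.

Definition open_converges (F : set (set X)) (x : X) : Prop :=
  forall U, open U -> U x -> F U.

Definition EX : Type :=
  {F : set (set X) | open_ultrafilter F /\ exists x, open_converges F x}.

Record section := Section {
  section_fun :> X -> EX;
  section_converges : forall x, open_converges (sval (section_fun x)) x
}.

Definition hat (b : section) (U : set X) : set X := [set x | sval (b x) U].

Definition c_op (b : section) (A : set X) : set X :=
  [set x | forall U, open U -> U x -> hat b U `&` A !=set0].

Definition c_closed (b : section) (A : set X) : Prop := c_op b A = A.

Definition is_aL (A : set X) : Type -> Prop :=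
  least_infinite_cardinal (fun K =>
    forall V : set (set X), open_cover_of A V ->
      exists W : set (set X),
        [/\ W `<=` V, W #<= [set: K] & A `<=` \bigcup_(U in W) closure U]).

(* [S + nat] is the cardinal sum S + aleph_0. *)
Definition is_aLb (b : section) (K : Type) : Prop :=
  exists S : Type,
    supremum_cardinal (fun K' => exists2 C, c_closed b C & is_aL C K') S /\
    [set: K] #= [set: (S + nat)%type].

Definition is_aLprime : Type -> Prop :=
  minimum_cardinal (fun K => exists b : section, is_aLb b K).

Definition minimizing_section (b : section) : Prop :=
  exists K : Type, is_aLb b K /\ is_aLprime K.

Definition is_Lprime (b : section) : Type -> Prop :=
  least_infinite_cardinal (fun K =>
    forall V : set (set X), open_cover_of setT V ->
      exists W : set (set X),
        [/\ W `<=` V, W #<= [set: K] & setT = \bigcup_(U in W) hat b U]).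

End Spaces.

(* Main.v *)
Require Import Defs.
From mathcomp Require Import all_boot all_classical topology.

Local Open Scope classical_set_scope.
Local Open Scope card_scope.

(* An open ultrafilter containing no member of a finite family of open sets
   contains an open set missing all of them. If the closures of the family
   cover X this is absurd, so every b(x) contains a member of the family; thus
   the finite subfamily given by H-closedness already witnesses that the
   L'-invariant of any section is countable. *)

(** Maximality forces this: an open set meeting every member of [F] could be adjoined to [F]. *)
Lemma open_ultrafilter_disjoint (X : topologicalType) (F : set (set X))
    (U : set X) :
  open_ultrafilter F -> open U -> ~ F U -> exists2 O, F O & O `&` U = set0.
Proof.
move=> [Ff Fmax] oU nFU; apply: contrapT => noO.
(* The open filter generated by [F] and [U]; its members are nonempty because, by [noO], every
   member of [F] meets [U]. *)
pose G := [set V | open V /\ exists2 O, F O & O `&` U `<=` V].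
have [O0 FO0] := open_filter_nonempty Ff.
have Gf : open_filter G.
  split.
  - by move=> V [].
  - exists U; split=> //; exists O0 => //; exact: subIsetr.
  - move=> V [_ [O FO OUV]]; apply/set0P/eqP => V0.
    by apply: noO; exists O => //; apply/seteqP; split=> // x /OUV; rewrite V0.
  - move=> V1 V2 [oV1 [O1 FO1 sub1]] [oV2 [O2 FO2 sub2]].
    split; first exact: openI.
    exists (O1 `&` O2); first exact: open_filterI.
    by move=> x [[O1x O2x] Ux]; split; [apply: sub1|apply: sub2].
  - move=> V1 V2 [_ [O FO sub]] oV2 V12; split=> //.
    by exists O => //; exact: subset_trans V12.
apply: nFU; rewrite -(Fmax G Gf).
- by split=> //; exists O0 => //; exact: subIsetr.
- move=> V FV; split; first exact: open_filter_open FV.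
  by exists V => //; exact: subIsetl.
Qed.

(** Finiteness of [W] keeps the intersection of the individual witnesses in [F]. *)
Lemma open_filter_disjoint_finite (X : topologicalType) (F W : set (set X)) :
  open_filter F -> finite_set W ->
  (forall U, W U -> exists2 O, F O & O `&` U = set0) ->
  exists2 O, F O & forall U, W U -> O `&` U = set0.
Proof.
move=> Ff /finite_seqP[s ->]; elim: s => [_|U s IHs disj].
  by have [O FO] := open_filter_nonempty Ff; exists O.
have [|O FO Os] := IHs.
  by move=> V /= Vs; apply: disj; rewrite /= inE Vs orbT.
have [|O' FO' O'U] := disj U; first by rewrite /= inE eqxx.
exists (O `&` O'); first exact: open_filterI.
move=> V /=; rewrite inE => /orP[/eqP->|Vs]; first by rewrite -setIA O'U setI0.
by rewrite setIAC (Os V) ?set0I.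
Qed.

Lemma open_ultrafilter_closure_cover (X : topologicalType)
    (F W : set (set X)) :
  open_ultrafilter F -> finite_set W -> (forall U, W U -> open U) ->
  setT = \bigcup_(U in W) closure U -> exists2 U, W U & F U.
Proof.
move=> Fu finW oW cov; apply: contrapT => nWF.
have [Ff _] := Fu.
have [|O FO OW] := open_filter_disjoint_finite _ _ _ Ff finW.
  move=> U WU; apply: open_ultrafilter_disjoint => //; first exact: oW.
  by move=> FU; apply: nWF; exists U.
(* A point [p] of [O] lies in the closure of some [U] in [W], so its open neighbourhood [O] meets
   [U], contradicting [OW]. *)
have [p Op] := open_filter_proper Ff FO.
have [U WU clUp] : (\bigcup_(U in W) closure U) p by rewrite -cov.
have /clUp[q [Uq Oq]] : nbhs p O.
  by apply: open_nbhs_nbhs; split=> //; exact: open_filter_open FO.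
by have : (O `&` U) q by []; rewrite OW.
Qed.

Theorem corollary3p5 (X : topologicalType) (hX : H_closed X)
  (b' : section X) (hb' : minimizing_section b') : is_Lprime b' nat.
Proof.
have [_ closedX] := hX; split.
- exact: infinite_nat.
- move=> V covV; have [oV _] := covV.
  have [W [finW WV cov]] := closedX V covV.
  exists W; split=> //; first exact: finite_set_countable.
  apply/seteqP; split=> // x _.
  have [bu _] := svalP (b' x).
  have [U WU bU] :=
    open_ultrafilter_closure_cover _ _ _ bu finW (fun U WU => oV U (WV U WU)) cov.
  by exists U.
(* Minimality: every infinite type contains a copy of [nat]. *)
- by move=> K' /infiniteP.
Qed.
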